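(* Near the origin (that is, for all complex $x$ in some neighbourhood of $0$), the value at $x$ of the continued fraction given by $\boldsymbol{w}_n$ converges to $\dfrac{A(x)}{C(x)}$ as $n\to\infty$.
   Context: A word is a finite sequence; $[\cdot,\cdot]$ denotes concatenation, $-\boldsymbol{w}$ is the word with all entries negated, $\overleftarrow{\boldsymbol{w}}$ is the reversed word. Define $\boldsymbol{w}_0$ as the empty word and $\boldsymbol{w}_n=[\boldsymbol{w}_{n-1},\,\boldsymbol{w}_{n-1},\,x,\,-\overleftarrow{\boldsymbol{w}_{n-1}},\,-\overleftarrow{\boldsymbol{w}_{n-1}}]$ for $n\ge1$. For $n\ge1$ a word $\boldsymbol{w}_n=[a_0,a_1,\dots,a_{k_n}]$, with $k_n=\#\boldsymbol{w}_n-1$ and $\#\boldsymbol{w}_n$ the length, is identified with the continued fraction $[a_0;a_1,\dots,a_{k_n}]=a_0+\cfrac{1}{a_1+\cfrac{1}{\ddots+\cfrac{1}{a_{k_n}}}}$, whose value is $p_{k_n}/q_{k_n}$, where $p_{-1}=1$, $q_{-1}=0$, $p_0=a_0$, $q_0=1$, $p_j=a_jp_{j-1}+p_{j-2}$, $q_j=a_jq_{j-1}+q_{j-2}$. The power series are $A(x)=\sum_{n\ge0}\frac{1}{n+1}\binom{3n+1}{n}x^{2n+1}=x+2x^3+7x^5+30x^7+\cdots$ and $C(x)=\sum_{n\ge0}\frac{1}{2n+1}\binom{3n}{n}x^{2n}=1+x^2+3x^4+12x^6+\cdots$; they satisfy $A(x)=xC(x)^2$ and $C(x)=1+x^2C(x)^3$.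 *)

(* Defs.v *)
From HB Require Import structures.
From mathcomp Require Import all_boot all_order all_algebra.
From mathcomp Require Import complex.
From mathcomp Require Import all_classical all_reals all_analysis.

Set Implicit Arguments.
Unset Strict Implicit.
Unset Printing Implicit Defensive.

Import Order.TTheory GRing.Theory Num.Theory.
Import numFieldNormedType.Exports.

Local Open Scope classical_set_scope.
Local Open Scope ring_scope.

Fixpoint word (K : zmodType) (x : K) (n : nat) : seq K :=
  if n is m.+1 then
    let w := word x m in
    let v := map -%R (rev w) in
    w ++ w ++ [:: x] ++ v ++ v
  else [::].

(* The index is shifted by one: [cf_num a j] is p_(j-1) and [cf_den a j] is
   q_(j-1) for the partial quotients a_0, a_1, ... *)
Fixpoint cf_num (K : nzRingType) (a : nat -> K) (j : nat) : K :=
  match j with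
  | 0 => 1
  | 1 => a 0
  | (i.+1 as k).+1 => a k * cf_num a k + cf_num a i
  end.

Fixpoint cf_den (K : nzRingType) (a : nat -> K) (j : nat) : K :=
  match j with
  | 0 => 0
  | 1 => 1
  | (i.+1 as k).+1 => a k * cf_den a k + cf_den a i
  end.

(* Because of the shift, the last convergent of [a_0, ..., a_k] has index
   k + 1 = size w. *)
Definition word_num (K : nzRingType) (w : seq K) : K :=
  cf_num (nth 0 w) (size w).

Definition word_den (K : nzRingType) (w : seq K) : K :=
  cf_den (nth 0 w) (size w).

(* Meaningful only when [word_den w != 0], since division is total. *)
Definition cf_value (K : fieldType) (w : seq K) : K := word_num w / word_den w.

Definition A_terms (K : numFieldType) (x : K) : nat -> K :=
  fun n => n.+1%:R^-1 * 'C(3 * n + 1, n)%:R * x ^+ (2 * n + 1).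

Definition C_terms (K : numFieldType) (x : K) : nat -> K :=
  fun n => (2 * n + 1)%:R^-1 * 'C(3 * n, n)%:R * x ^+ (2 * n).

(* The sums are total limits, meaningful when the series converge. *)
Definition A_sum (K : numFieldType) (x : K) : K := limn (series (A_terms x)).

Definition C_sum (K : numFieldType) (x : K) : K := limn (series (C_terms x)).

(* The field R[i] has its norm topology through its numFieldType structure. *)
Definition complexes (R : realType) : numFieldType := R[i]%C.

(* Main.v *)
Require Import Defs.
From mathcomp Require Import all_boot all_order all_algebra.
From mathcomp Require Import complex.
From mathcomp Require Import all_classical all_reals all_analysis.
From mathcomp Require Import ring lra zify.
Import Order.TTheory GRing.Theory Num.Theory.
Import numFieldNormedType.Exports.

(** Multiplying the matrices [[a, 1], [1, 0]] over the entries a of a word w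
    gives a matrix M(w) whose first column holds the numerator and the
    denominator of its continued fraction.  Conjugating [[a, 1], [1, 0]] by the
    swap matrix P = [[0, 1], [1, 0]] gives the inverse of [[-a, 1], [1, 0]];
    hence negating and reversing w replaces M(w) by the inverse of
    P M(w) P ([cf_matrix_negrev]).  So if N = M(w_n)^2, which has
    determinant 1, then M(w_(n+1)) = N X P N^-1 P with X = [[x, 1], [1, 0]], and
    this depends on the first column (a, c) of N only
    ([cf_matrix_sandwich]):

      M(w_(n+1)) = [[x a^2, 1 - x a c], [1 + x a c, - x c^2]].

    Squaring it gives a recursion on first columns, starting at (1, 0):

      (a, c) |-> (1 + x^2 a^2 (a^2 - c^2), x (1 + x a c) (a^2 - c^2)),

    and the value of w_(n+1) is x a^2 / (1 + x a c).

    For small x this map preserves the box |a| <= 2, |c| <= 1 and halves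
    distances there, so its orbit of (1, 0) converges to any fixed point in the
    box ([square_column_cvg]), and 1 + x a c stays away from 0.  The fixed point
    is (C, A): from C = 1 + x^2 C^3 and A = x C^2 one gets
    C^2 - A^2 = C (C - x^2 C^3) = C and 1 + x C A = C, after which both
    coordinates are immediate.  The limit of the values is x C^2 / C = A / C.

    The two equations for C and A are identities between power series in
    z = x^2.  The coefficients of C and of A / x are the Raney numbers
    r / (3n + r) binom(3n + r, n) with r = 1 and r = 2 ([raney_bin]), the
    coefficient of z^n in the r-th power of the solution of B = 1 + z B^3.
    They satisfy a convolution identity ([raney_conv]) and grow at most like
    8^n ([raney_le]), so a Cauchy product of geometrically dominated series
    ([cauchy_product]) shows that their sums multiply as powers of B do
    ([raney_sumM]). *)

Set Implicit Arguments.
Unset Strict Implicit.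
Unset Printing Implicit Defensive.

Local Open Scope classical_set_scope.
Local Open Scope ring_scope.

(** * Raney numbers *)

(** The coefficient of z^n in B^r, where B = 1 + z B^3: the recursion on r
    reads B^(r+1) = B^r + z B^(r+3). *)
Fixpoint raney (n r : nat) {struct n} : nat :=
  if n is n'.+1 then
    (fix aux (r : nat) : nat :=
       if r is r'.+1 then (aux r' + raney n' r'.+3)%N else 0%N) r
  else 1%N.

Lemma raneyS0 n : raney n.+1 0 = 0%N. Proof. by []. Qed.
Lemma raneySS n r : raney n.+1 r.+1 = (raney n.+1 r + raney n r.+3)%N.
Proof. by []. Qed.

(** This is B^r B^s = B^(r+s) read off coefficientwise.  The recursion on r
    moves from r to r + 3 while lowering n, hence the outer induction on n for
    all r and s. *)
Lemma raney_conv n r s :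
  (\sum_(k < n.+1) raney k r * raney (n - k) s)%N = raney n (r + s).
Proof.
elim: n r s => [|n IHn] r s; first by rewrite big_ord1.
elim: r => [|r IHr].
  by rewrite big_ord_recl big1 ?addn0 ?mul1n ?subn0 // => k _; rewrite raneyS0.
rewrite addSn raneySS -IHr -!addSn -IHn !(big_ord_recl n.+1).
rewrite -addnA -big_split /=; congr (_ + _)%N.
by apply: eq_bigr => k _; rewrite -mulnDl.
Qed.

Lemma raney_bin n r :
  ((3 * n + r) * raney n r = r * 'C(3 * n + r, n))%N.
Proof.
elim: n r => [|n IHn] r; first by rewrite bin0.
elim: r => [|r IHr]; first by rewrite raneyS0 muln0.
rewrite raneySS.
have IH := IHn r.+3.
have eN : (3 * n + r.+3 = 3 * n.+1 + r)%N by lia.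
rewrite eN in IH.
set N := (3 * n.+1 + r)%N in IH IHr *.
have -> : (3 * n.+1 + r.+1 = N.+1)%N by rewrite /N; lia.
have N0 : (0 < N)%N by rewrite /N; lia.
have e2 := mul_bin_left N n.
have e4 : (N - n = 2 * n + 3 + r)%N by rewrite /N; lia.
rewrite e4 in e2.
(* After multiplication by N, the two summands of the recursion are known by
   induction; after multiplication by n + 1, everything is a multiple of
   the binomial coefficient (N, n). *)
apply/eqP; rewrite -(eqn_pmul2l N0) -(eqn_pmul2l (ltn0Sn n)); apply/eqP.
move: IH IHr e2; rewrite binS.
move: (raney _ _) (raney _ _) 'C(N, n.+1) 'C(N, n) => P Q X Y IH IHr e2.
have eN' : (N = 3 * n + 3 + r)%N by rewrite /N; lia.
have -> : (n.+1 * (N * (N.+1 * (P + Q))) =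
  N.+1 * (n.+1 * (N * P + N * Q)))%N by ring.
rewrite IHr IH.
have -> : (n.+1 * (r * X + r.+3 * Y) =
  r * (n.+1 * X) + n.+1 * r.+3 * Y)%N by ring.
have -> : (n.+1 * (N * (r.+1 * (X + Y))) =
  N * r.+1 * (n.+1 * X) + N * r.+1 * n.+1 * Y)%N by ring.
by rewrite e2 eN'; ring.
Qed.

(** The constants come from z = 1 / 8, where B = 2 solves B = 1 + z B^3. *)
Lemma raney_le n r : (raney n r <= 2 ^ r * 8 ^ n)%N.
Proof.
elim: n r => [|n IHn] r; first by rewrite muln1 expn_gt0.
elim: r => [//|r IHr].
rewrite raneySS (leq_trans (leq_add IHr (IHn _))) // !expnS; lia.
Qed.

(** * Continued fractions as matrix products *)

Section Matrix2.
Variable K : comNzRingType.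
Implicit Types (a b c d x : K) (w : seq K).

Definition mx2 a b c d : 'M[K]_2 :=
  \matrix_(i < 2, j < 2)
    if i == 0 then (if j == 0 then a else b) else (if j == 0 then c else d).

Lemma mul_mx2 a b c d a' b' c' d' :
  mx2 a b c d * mx2 a' b' c' d' =
  mx2 (a * a' + b * c') (a * b' + b * d') (c * a' + d * c') (c * b' + d * d').
Proof.
apply/matrixP => i j; rewrite !mxE !big_ord_recl big_ord0 !mxE /= addr0.
by case: ifP => _; case: ifP.
Qed.

Lemma mx2_1 : 1 = mx2 1 0 0 1.
Proof. by apply/matrixP => -[[|[|//]] ?] [[|[|//]] ?]; rewrite !mxE. Qed.

Definition cf_matrix w : 'M[K]_2 := \prod_(a <- w) mx2 a 1 1 0.

Lemma cf_matrix_cat w1 w2 :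
  cf_matrix (w1 ++ w2) = cf_matrix w1 * cf_matrix w2.
Proof. exact: big_cat. Qed.

Lemma cf_matrix1 a : cf_matrix [:: a] = mx2 a 1 1 0.
Proof. exact: big_seq1. Qed.

Lemma prod_convergents (a : nat -> K) j :
  \prod_(i < j.+1) mx2 (a i) 1 1 0 =
  mx2 (cf_num a j.+1) (cf_num a j) (cf_den a j.+1) (cf_den a j).
Proof.
elim: j => [|j IHj]; first by rewrite big_ord1.
rewrite big_ord_recr IHj /= mul_mx2; congr mx2; ring.
Qed.

Lemma cf_matrix_num_den w :
  cf_matrix w 0 0 = word_num w /\ cf_matrix w 1 0 = word_den w.
Proof.
have E : cf_matrix w = \prod_(i < size w) mx2 (nth 0 w i) 1 1 0.
  by rewrite /cf_matrix (big_nth 0) big_mkord.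
rewrite E /word_num /word_den; case: (size w) => [|m].
  by rewrite big_ord0 mx2_1 !mxE.
by rewrite prod_convergents !mxE.
Qed.

(** Conjugation by the swap matrix inverts each factor up to the sign of its
    entry: [[-a, 1], [1, 0]] is inverse to [[0, 1], [1, a]].  In the product the
    order of the factors is reversed, as it is in an inverse. *)
Lemma cf_matrix_negrev w :
  cf_matrix (map -%R (rev w)) * (mx2 0 1 1 0 * cf_matrix w * mx2 0 1 1 0) = 1.
Proof.
elim: w => [|a w IHw].
  by rewrite /cf_matrix !big_nil mul1r mulr1 mul_mx2 mx2_1; congr mx2; ring.
rewrite rev_cons map_rcons -cats1 cf_matrix_cat cf_matrix1 -cat1s cf_matrix_cat.
rewrite cf_matrix1 -[RHS]IHw -!mulrA; congr (_ * _).
rewrite !mulrA; congr (_ * _ * _).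
by rewrite !mul_mx2; congr mx2; ring.
Qed.

Lemma det_mx2 a b c d : \det (mx2 a b c d) = a * d - b * c.
Proof.
rewrite (expand_det_row _ 0) !big_ord_recl big_ord0 /cofactor !det_mx11 !mxE /=.
by rewrite expr0 expr1; ring.
Qed.

Lemma det_cf_matrix_sqr w : \det (cf_matrix w * cf_matrix w) = 1.
Proof.
rewrite det_mulmx; elim: w => [|a w IHw].
  by rewrite /cf_matrix big_nil det1 mulr1.
rewrite -cat1s cf_matrix_cat det_mulmx cf_matrix1 det_mx2 mulrACA IHw; ring.
Qed.

(** With N = M(w)^2 and P the swap matrix, the product is N X P N^-1 P.
    Here X P = [[1, x], [0, 1]], so the product is P plus x times a matrix of
    rank one built from the first column of N and the second row of N^-1; the
    latter has the same entries up to order and sign.  Squaring M(w) makes its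
    determinant, which is 1 or -1, equal to 1, so that the inverse is the
    adjugate. *)
Lemma cf_matrix_sandwich x w a b c d (v := map -%R (rev w)) :
  cf_matrix w * cf_matrix w = mx2 a b c d ->
  cf_matrix (w ++ w ++ [:: x] ++ v ++ v) =
  mx2 (x * a ^+ 2) (1 - x * a * c) (1 + x * a * c) (- (x * c ^+ 2)).
Proof.
move=> E.
have detE : a * d = 1 + b * c.
  by apply/eqP; rewrite -subr_eq -det_mx2 -E det_cf_matrix_sqr.
have swap2 : mx2 0 1 1 0 * mx2 0 1 1 0 = 1.
  by rewrite mul_mx2 mx2_1; congr mx2; ring.
have vE : cf_matrix v * cf_matrix v = mx2 a (- c) (- b) d.
  have invE : cf_matrix v * cf_matrix v *
      (mx2 0 1 1 0 * (cf_matrix w * cf_matrix w) * mx2 0 1 1 0) = 1.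
    have vw : cf_matrix v * (mx2 0 1 1 0 * cf_matrix w * mx2 0 1 1 0) = 1.
      exact: cf_matrix_negrev.
    move: swap2 vw; set P := mx2 0 1 1 0 => swap2 vw.
    have -> : P * (cf_matrix w * cf_matrix w) * P =
        (P * cf_matrix w * P) * (P * cf_matrix w * P).
      by rewrite -!mulrA (mulrA P P) swap2 mul1r.
    by rewrite mulrA -(mulrA (cf_matrix v)) vw mulr1 vw.
  have unitE : mx2 0 1 1 0 * mx2 a b c d * mx2 0 1 1 0 *
      mx2 a (- c) (- b) d = 1.
    by rewrite !mul_mx2 mx2_1; congr mx2; ring: detE.
  by rewrite -[LHS]mulr1 -unitE mulrA -E invE mul1r.
rewrite !cf_matrix_cat cf_matrix1 vE mulrA E !mul_mx2.
by congr mx2; ring: detE.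
Qed.

(** The effect of one step of the recursion on the first column of M(w_n)^2:
    the first column of the square of the matrix in [cf_matrix_sandwich]. *)
Definition square_step x (p : K * K) : K * K :=
  (1 + x ^+ 2 * (p.1 ^+ 2 * (p.1 ^+ 2 - p.2 ^+ 2)),
   x * ((1 + x * (p.1 * p.2)) * (p.1 ^+ 2 - p.2 ^+ 2))).

Definition square_column x n : K * K := iter n (square_step x) (1, 0).

Lemma cf_matrix_word_sqr x n :
  exists b d, cf_matrix (word x n) * cf_matrix (word x n) =
    mx2 (square_column x n).1 b (square_column x n).2 d.
Proof.
elim: n => [|n [b [d E]]].
  by exists 0, 1; rewrite /cf_matrix big_nil mulr1 mx2_1.
rewrite [word _ _]/= (cf_matrix_sandwich x E) mul_mx2 /=.
by eexists _, _; congr mx2; ring.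
Qed.

Lemma word_num_den x n (p := square_column x n) :
  word_num (word x n.+1) = x * p.1 ^+ 2 /\
  word_den (word x n.+1) = 1 + x * (p.1 * p.2).
Proof.
have [b [d /(cf_matrix_sandwich x) E]] := cf_matrix_word_sqr x n.
case: (cf_matrix_num_den (word x n.+1)) => <- <-.
by rewrite [word _ _]/= E !mxE /= mulrA.
Qed.

End Matrix2.

(** * Convergence of complex sequences and series *)

Section ComplexLimits.
Variable R : realType.
Implicit Types (z w : complexes R) (u v : nat -> complexes R) (q e : R).

(** The norm of a complex number is itself complex, and the order of the complex
    numbers is partial; estimates are made on this real modulus. *)
Definition modulus z : R := complex.Re `|z|.

Lemma modulusE z : `|z| = (modulus z)%:C%C.
Proof. by rewrite /modulus; case: z => a b. Qed.

Lemma modulus_ge0 z : 0 <= modulus z.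
Proof. by rewrite -lecR -modulusE normr_ge0. Qed.

Lemma modulusD z w : modulus (z + w) <= modulus z + modulus w.
Proof. by rewrite -lecR rmorphD /= -!modulusE ler_normD. Qed.

Lemma modulusM z w : modulus (z * w) = modulus z * modulus w.
Proof. by apply: (@complexI R); rewrite rmorphM /= -!modulusE normrM. Qed.

Lemma modulusN z : modulus (- z) = modulus z.
Proof. by rewrite /modulus normrN. Qed.

Lemma modulus0 : modulus 0 = 0.
Proof. by rewrite /modulus normr0. Qed.

Lemma modulus1 : modulus 1 = 1.
Proof. by rewrite /modulus normr1. Qed.

Lemma modulusX z n : modulus (z ^+ n) = modulus z ^+ n.
Proof.
by elim: n => [|n IHn]; rewrite ?expr0 ?modulus1 // !exprS modulusM IHn.
Qed.

Lemma modulus_nat n : modulus n%:R = n%:R.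
Proof. by apply: (@complexI R); rewrite -modulusE rmorph_nat normr_nat. Qed.

Lemma modulus_sum (I : Type) (r : seq I) (P : pred I) (F : I -> complexes R) :
  modulus (\sum_(i <- r | P i) F i) <= \sum_(i <- r | P i) modulus (F i).
Proof.
elim/big_rec2: _ => [|i y1 y2 _ le12]; first by rewrite modulus0.
by rewrite (le_trans (modulusD _ _)) ?lerD2l.
Qed.

Lemma modulus_sqrt z :
  modulus z = Num.sqrt (complex.Re z ^+ 2 + complex.Im z ^+ 2).
Proof. by rewrite /modulus normc_def. Qed.

Lemma modulus_Re_Im z : modulus z <= `|complex.Re z| + `|complex.Im z|.
Proof.
rewrite modulus_sqrt -[leRHS]ger0_norm ?addr_ge0 // -[leRHS]sqrtr_sqr.
apply: ler_wsqrtr; rewrite sqrrD !real_normK ?num_real //.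
by rewrite lerD2r lerDl mulrn_wge0 // mulr_ge0.
Qed.

Lemma modulus_ge_Re z : `|complex.Re z| <= modulus z.
Proof. by rewrite -lecR -modulusE normc_ge_Re. Qed.

Lemma modulus_ge_Im z : `|complex.Im z| <= modulus z.
Proof.
by rewrite modulus_sqrt -sqrtr_sqr; apply: ler_wsqrtr; rewrite lerDr sqr_ge0.
Qed.

Lemma cvg_of_modulus u z (e : nat -> R) :
  (forall n, modulus (u n - z) <= e n) -> e @ \oo --> 0 -> u @ \oo --> z.
Proof.
move=> ule e0; apply/cvgrPdist_lt => eps eps0.
have [d d0 ->] : exists2 d : R, 0 < d & eps = d%:C%C.
  exists (complex.Re eps); last by rewrite RRe_real // ger0_real // ltW.
  by rewrite -ltcR RRe_real // ger0_real // ltW.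
move/cvgrPdist_lt: e0 => /(_ d d0); apply: filterS => n.
rewrite sub0r normrN => en.
rewrite distrC modulusE ltcR (le_lt_trans (ule n)) //.
by rewrite (le_lt_trans (ler_norm _)).
Qed.

Lemma modulus_cvg_le u z (M : R) :
  (forall n, modulus (u n) <= M) -> u @ \oo --> z -> modulus z <= M.
Proof.
move=> uM uz; rewrite leNgt; apply/negP => Mz.
move/cvgrPdist_lt: uz => /(_ (modulus z - M)%:C%C).
rewrite ltcR subr_gt0 => /(_ Mz) [N _ /(_ N (leqnn _))] /=.
rewrite modulusE ltcR => h.
have := modulusD (z - u N) (u N); rewrite subrK.
have := uM N; lra.
Qed.

(** The real and imaginary parts are absolutely convergent real series, so
    completeness of the reals suffices. *)
Lemma geometric_dominated_cvg u (k q : R) : 0 <= q < 1 ->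
  (forall n, modulus (u n) <= k * q ^+ n) -> cvgn (series u).
Proof.
move=> /andP[q0 q1] uq.
have cvgR (f : nat -> R) :
    (forall n, `|f n| <= modulus (u n)) -> cvgn (series f).
  move=> fu; apply: normed_cvg; apply: (@series_le_cvg _ _ (geometric k q)).
  - by move=> n; apply: normr_ge0.
  - by move=> n; exact: (le_trans (modulus_ge0 _) (uq n)).
  - by move=> n; exact: (le_trans (fu n) (uq n)).
  - by apply: is_cvg_geometric_series; rewrite ger0_norm.
have /cvgR re := fun n => modulus_ge_Re (u n).
have /cvgR im := fun n => modulus_ge_Im (u n).
set fr := fun n => complex.Re (u n) in re *.
set fi := fun n => complex.Im (u n) in im *.
apply/cvg_ex; exists (Complex (limn (series fr)) (limn (series fi))).
apply: (@cvg_of_modulus _ _ (fun n => `|series fr n - limn (series fr)| +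
    `|series fi n - limn (series fi)|)) => [n|].
  apply: le_trans (modulus_Re_Im _) _.
  have RE : complex.Re (series u n) = series fr n.
    rewrite /series /=; elim: n => [|n IHn]; first by rewrite !big_geq.
    rewrite !big_nat_recr //= -IHn /fr.
    by case: (\sum_(_ <= _ < _) _) (u n) => ? ? [].
  have IE : complex.Im (series u n) = series fi n.
    rewrite /series /=; elim: n {RE} => [|n IHn]; first by rewrite !big_geq.
    rewrite !big_nat_recr //= -IHn /fi.
    by case: (\sum_(_ <= _ < _) _) (u n) => ? ? [].
  by rewrite -RE -IE; case: (series u n).
rewrite -[X in _ --> X](addr0 0); apply: cvgD.
  by rewrite -[X in _ --> X](normr0 R); apply: cvg_norm; apply/subr_cvg0.
by rewrite -[X in _ --> X](normr0 R); apply: cvg_norm; apply/subr_cvg0.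
Qed.

Lemma sum_geometric_le (q : R) n : 0 <= q <= 2^-1 -> \sum_(i < n) q ^+ i <= 2.
Proof.
move=> /andP[q0 q1].
suff: \sum_(i < n) q ^+ i <= 2 - 2 * q ^+ n.
  by move=> /le_trans; apply; rewrite gerBl mulr_ge0 // exprn_ge0.
elim: n => [|n IHn]; first by rewrite big_ord0 expr0; lra.
rewrite big_ord_recr /= exprS; have := exprn_ge0 n q0; nra.
Qed.

(** The N-th partial sum of the Cauchy product is the sum of u_i V_(N-i) over
    i < N, where V_m is the m-th partial sum of v.  It differs from U_N V_N by
    the sum of u_i (V_N - V_(N-i)); each of these N terms is at most 2 k l q^N,
    and N q^N <= (2 q)^N tends to 0. *)
Lemma cauchy_product u v (k l q : R) (su sv : complexes R) : 0 <= q <= 4^-1 ->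
  0 <= k -> 0 <= l ->
  (forall n, modulus (u n) <= k * q ^+ n) ->
  (forall n, modulus (v n) <= l * q ^+ n) ->
  series u @ \oo --> su -> series v @ \oo --> sv ->
  series (fun n => \sum_(i < n.+1) u i * v (n - i)%N) @ \oo --> su * sv.
Proof.
move=> /andP[q0 q4] k0 l0 uq vq su_cvg sv_cvg.
set w : nat -> complexes R := fun n => \sum_(i < n.+1) u i * v (n - i)%N.
have wE N : series w N = \sum_(i < N) u i * series v (N - i)%N.
  elim: N => [|N IHN]; first by rewrite seriesEord /= !big_ord0.
  rewrite seriesSr IHN /w !big_ord_recr /= addrA; congr (_ + _).
    rewrite -big_split; apply: eq_bigr => i _ /=.
    by rewrite subSn ?(ltnW (ltn_ord i)) // seriesSr mulrDr.
  by rewrite subnn subSnn seriesSr {1}/series /= big_geq // add0r.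
have tail m i : modulus (series v (m + i)%N - series v m) <= l * q ^+ m * 2.
  have -> : series v (m + i)%N - series v m = \sum_(j < i) v (m + j)%N.
    elim: i => [|i IHi]; first by rewrite addn0 subrr big_ord0.
    by rewrite addnS seriesSr big_ord_recr /= -IHi addrAC.
  apply: le_trans (modulus_sum _ _ _) _.
  apply: le_trans (ler_sum _ (fun j _ => vq _)) _.
  under eq_bigr do rewrite exprD mulrA.
  rewrite -mulr_sumr ler_wpM2l ?mulr_ge0 ?exprn_ge0 //.
  apply: sum_geometric_le; lra.
have prod_cvg := cvgM su_cvg sv_cvg.
have err_cvg : (fun n => series u n * series v n - series w n) @ \oo -->
    (0 : complexes R).
  apply: (@cvg_of_modulus _ _ (geometric (k * l * 2) (2 * q))) => [N|].
    rewrite subr0 wE {1}seriesEord /= mulr_suml -sumrB.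
    apply: le_trans (modulus_sum _ _ _) _.
    have le_term (i : 'I_N) : true -> modulus (u i * series v N -
        u i * series v (N - i)%N) <= k * l * 2 * q ^+ N.
      move=> _; rewrite -mulrBr modulusM.
      have := tail (N - i)%N i; rewrite subnK 1?ltnW // => tl.
      apply: le_trans (ler_pM (modulus_ge0 _) (modulus_ge0 _) (uq i) tl) _.
      rewrite -[in leRHS](subnKC (ltnW (ltn_ord i))) exprD.
      by rewrite le_eqVlt; apply/orP; left; apply/eqP; ring.
    apply: le_trans (ler_sum _ le_term) _.
    have kq0 : 0 <= k * l * 2 * q ^+ N by rewrite !mulr_ge0 ?exprn_ge0.
    rewrite sumr_const card_ord -[leLHS]mulr_natr /= exprMn mulrCA [leRHS]mulrC.
    rewrite ler_wpM2l // -natrX ler_nat.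
    exact: ltnW (ltn_expl _ _).
  by apply: cvg_geometric; rewrite ger0_norm; lra.
have -> : series w = (series u \* series v) \-
    (fun n => series u n * series v n - series w n).
  by apply/funext => n /=; rewrite opprB addrC subrK.
by rewrite -[X in _ --> X]subr0; apply: cvgB err_cvg; apply: prod_cvg.
Qed.

End ComplexLimits.

(** * Generating functions of the Raney numbers *)

Section GeneratingFunction.
Variables (R : realType) (z : complexes R).
(* The coefficients grow at most like 8^n, and the Cauchy product is taken for
   ratios up to 1 / 4. *)
Hypothesis z_small : modulus z <= 32^-1.

Definition raney_terms r n : complexes R := (raney n r)%:R * z ^+ n.
Definition raney_sum r : complexes R := limn (series (raney_terms r)).

Lemma raney_terms_le r n :
  modulus (raney_terms r n) <= 2 ^+ r * (8 * modulus z) ^+ n.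
Proof.
rewrite modulusM modulus_nat modulusX exprMn mulrA.
rewrite ler_wpM2r ?exprn_ge0 ?modulus_ge0 //.
by rewrite -!natrX -natrM ler_nat raney_le.
Qed.

Let ratio_bounds : 0 <= 8 * modulus z <= 4^-1.
Proof. by have := modulus_ge0 z; move: z_small; lra. Qed.

Lemma raney_series_cvg r : series (raney_terms r) @ \oo --> raney_sum r.
Proof.
apply: (@geometric_dominated_cvg R _ (2 ^+ r) (8 * modulus z)).
  by move: ratio_bounds; lra.
exact: raney_terms_le.
Qed.

Lemma raney_sumM r s : raney_sum r * raney_sum s = raney_sum (r + s).
Proof.
have := @cauchy_product R _ _ _ _ _ _ _ ratio_bounds _ _
  (raney_terms_le r) (raney_terms_le s)
  (@raney_series_cvg r) (@raney_series_cvg s).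
move=> /(_ (exprn_ge0 _ (ler0n _ _)) (exprn_ge0 _ (ler0n _ _))) prod_cvg.
apply/esym/cvg_lim; first exact: norm_hausdorff.
have -> // : raney_terms (r + s) =
  fun n => \sum_(i < n.+1) raney_terms r i * raney_terms s (n - i)%N.
apply/funext => n; rewrite /raney_terms -raney_conv natr_sum mulr_suml.
apply: eq_bigr => i _.
by rewrite natrM mulrACA -exprD subnKC // -ltnS.
Qed.

(** The coefficients of B are those of z B^3 shifted by one, because the Raney
    numbers with r = 0 vanish in positive degree. *)
Lemma raney_sum1 : raney_sum 1 = 1 + z * raney_sum 3.
Proof.
apply: cvg_lim; first exact: norm_hausdorff.
rewrite -cvg_shiftS.
have -> : [sequence series (raney_terms 1) n.+1]_n =
    (cst 1 \+ (cst z \* series (raney_terms 3))).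
  apply/funext => n /=; rewrite /series /= big_nat_recl // /raney_terms mul1r.
  congr (_ + _); rewrite mulr_sumr; apply: eq_bigr => i _.
  by rewrite raneySS raneyS0 add0n exprS mulrCA.
apply: cvgD; first exact: cvg_cst.
apply: cvgM; [exact: cvg_cst | exact: raney_series_cvg].
Qed.

(** For r = 1 the factor 2^r of the general bound can be dropped, since in
    positive degree these are the Raney numbers with r = 3 one degree lower. *)
Lemma modulus_raney_sum1 : modulus (raney_sum 1) <= 2.
Proof.
apply: (modulus_cvg_le _ (@raney_series_cvg 1)) => n.
rewrite /series /= big_mkord.
apply: le_trans (modulus_sum _ _ _) _.
apply: le_trans (@sum_geometric_le R (8 * modulus z) n _); last first.
  by move: ratio_bounds; lra.
apply: ler_sum => -[[|i] _] _ /=.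
  by rewrite /raney_terms mul1r !expr0 modulus1.
rewrite /raney_terms raneySS raneyS0 add0n.
rewrite modulusM modulus_nat modulusX exprMn.
rewrite ler_wpM2r ?exprn_ge0 ?modulus_ge0 //.
by rewrite -natrX ler_nat expnS; apply: raney_le.
Qed.

End GeneratingFunction.

Lemma C_termsE (R : realType) (x : complexes R) :
  C_terms x = raney_terms (x ^+ 2) 1.
Proof.
apply/funext => n; rewrite /C_terms /raney_terms -exprM; congr (_ * _).
have n0 : (2 * n + 1)%:R != 0 :> complexes R by rewrite pnatr_eq0 addn1.
apply: (mulfI n0); rewrite mulVKf // -natrM; congr _%:R.
have e1 := raney_bin n 1; have := mul_bin_down (3 * n).+1 n.
have -> : ((3 * n).+1 - n = 2 * n + 1)%N by lia.
rewrite mul1n in e1; rewrite -addn1 -e1 => e2.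
have N0 : (0 < 3 * n + 1)%N by lia.
apply/eqP; rewrite -(eqn_pmul2l N0) mulnCA -e2; apply/eqP.
congr (_ * 'C(_, _))%N; lia.
Qed.

Lemma A_termsE (R : realType) (x : complexes R) n :
  A_terms x n = x * raney_terms (x ^+ 2) 2 n.
Proof.
rewrite /A_terms /raney_terms -exprM [(2 * n + 1)%N]addn1 exprS mulrCA.
congr (_ * (_ * _)).
have n0 : n.+1%:R != 0 :> complexes R by rewrite pnatr_eq0.
apply: (mulfI n0); rewrite mulVKf // -natrM; congr _%:R.
have e1 := raney_bin n 2; have := mul_bin_down (3 * n + 2) n.
have -> : (3 * n + 2 - n = 2 * n.+1)%N by lia.
have -> : (3 * n + 2).-1 = (3 * n + 1)%N by lia.
rewrite mulnAC -e1 => e2.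
have N0 : (0 < 3 * n + 2)%N by lia.
by apply/eqP; rewrite -(eqn_pmul2l N0) e2; apply/eqP; ring.
Qed.

(** * The recursion is a contraction *)

Section Contraction.
Variable R : realType.
Implicit Types (x a c u v : complexes R) (p q e f : R).

Lemma modulus_sub_le u v p q :
  modulus u <= p -> modulus v <= q -> modulus (u - v) <= p + q.
Proof.
by move=> up vq; rewrite (le_trans (modulusD _ _)) // modulusN lerD.
Qed.

Lemma modulusM_le u v p q :
  modulus u <= p -> modulus v <= q -> modulus (u * v) <= p * q.
Proof. by move=> up vq; rewrite modulusM ler_pM ?modulus_ge0. Qed.

Lemma modulus_mul_sub_le u u' v v' p q e f :
  modulus u <= p -> modulus v' <= q ->
  modulus (u - u') <= e -> modulus (v - v') <= f ->
  modulus (u * v - u' * v') <= p * f + e * q.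
Proof.
move=> up vq ue vf.
have -> : u * v - u' * v' = u * (v - v') + (u - u') * v' by ring.
by rewrite (le_trans (modulusD _ _)) // lerD ?modulusM_le.
Qed.

Definition in_box (s : complexes R * complexes R) :=
  modulus s.1 <= 2 /\ modulus s.2 <= 1.

Definition dist1 (s t : complexes R * complexes R) : R :=
  modulus (s.1 - t.1) + modulus (s.2 - t.2).

(** The box contains both the starting point (1, 0) and the fixed point (C, A),
    which are within O(x) of each other. *)
Lemma square_step_box x s : modulus x <= 100^-1 ->
  in_box s -> in_box (square_step x s).
Proof.
case: s => a c; rewrite /in_box /= => x1 [a2 c1].
have aa := modulusM_le a2 a2; have cc := modulusM_le c1 c1.
have t5 := modulus_sub_le aa cc; rewrite -!expr2 in t5 aa cc.
have xx := modulusM_le x1 x1; rewrite -expr2 in xx.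
have := modulusM_le xx (modulusM_le aa t5).
have xac := modulusM_le x1 (modulusM_le a2 c1).
have := modulusD 1 (x * (a * c)); rewrite modulus1 => den.
have den2 : modulus (1 + x * (a * c)) <= 2 by lra.
have := modulusM_le x1 (modulusM_le den2 t5).
have := modulusD 1 (x ^+ 2 * (a ^+ 2 * (a ^+ 2 - c ^+ 2))).
rewrite modulus1; lra.
Qed.

(** Both components of the step have a factor x in front of everything that
    depends on (a, c), and the box bounds the remaining partial derivatives. *)
Lemma square_step_contracts x s t : modulus x <= 100^-1 ->
  in_box s -> in_box t ->
  dist1 (square_step x s) (square_step x t) <= 2^-1 * dist1 s t.
Proof.
case: s t => a c [a' c']; rewrite /in_box /dist1 /= => x1 [a2 c1] [a'2 c'1].
set e := modulus (a - a'); set f := modulus (c - c').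
have ae : modulus (a - a') <= e by [].
have cf : modulus (c - c') <= f by [].
have sq_bound u p (h : modulus u <= p) := modulusM_le h h.
have aa := sq_bound _ _ a2; have cc := sq_bound _ _ c1.
have aa' := sq_bound _ _ a'2; have cc' := sq_bound _ _ c'1.
have xx := sq_bound _ _ x1.
have daa := modulus_mul_sub_le a2 a'2 ae ae.
have dcc := modulus_mul_sub_le c1 c'1 cf cf.
have t'5 := modulus_sub_le aa' cc'.
have dt0 := modulus_sub_le daa dcc.
rewrite -!expr2 in aa cc aa' cc' xx daa t'5 dt0.
have dt : modulus ((a ^+ 2 - c ^+ 2) - (a' ^+ 2 - c' ^+ 2)) <= 4 * e + 2 * f.
  have -> : (a ^+ 2 - c ^+ 2) - (a' ^+ 2 - c' ^+ 2) =
    (a ^+ 2 - a' ^+ 2) - (c ^+ 2 - c' ^+ 2) by ring.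
  by apply: le_trans dt0 _; lra.
have dat := modulus_mul_sub_le aa t'5 daa dt.
have := modulusM_le xx dat.
have xac := modulusM_le x1 (modulusM_le a2 c1).
have := modulusD 1 (x * (a * c)); rewrite modulus1 => den.
have den2 : modulus (1 + x * (a * c)) <= 2 by lra.
have dac := modulus_mul_sub_le a2 c'1 ae cf.
have dden := modulusM_le x1 dac.
have denE : x * (a * c - a' * c') = (1 + x * (a * c)) - (1 + x * (a' * c')).
  by ring.
rewrite denE in dden.
have ddt := modulus_mul_sub_le den2 t'5 dden dt.
have := modulusM_le x1 ddt.
have cancel1 u v : (1 + u) - (1 + v) = u - v by ring.
rewrite cancel1 -!mulrBr.
have e0 : 0 <= e := modulus_ge0 _; have f0 : 0 <= f := modulus_ge0 _.
lra.
Qed.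

Lemma square_column_box x n : modulus x <= 100^-1 ->
  in_box (square_column x n).
Proof.
move=> x1; elim: n => [|n IHn]; last exact: square_step_box.
by rewrite /in_box /= modulus0 modulus1; split; lra.
Qed.

End Contraction.

Lemma square_column_cvg (R : realType) (x : complexes R) s :
  modulus x <= 100^-1 -> in_box s -> square_step x s = s ->
  (fun n => (square_column x n).1) @ \oo --> s.1 /\
  (fun n => (square_column x n).2) @ \oo --> s.2.
Proof.
move=> x1 sbox sfix.
have box n := square_column_box n x1.
have dist n : dist1 (square_column x n) s <=
    geometric (dist1 (1, 0) s) 2^-1 n.
  elim: n => [|n IHn] /=; first by rewrite expr0 mulr1.
  rewrite -{1}sfix.
  apply: le_trans (square_step_contracts x1 (box n) sbox) _.
  rewrite exprS mulrCA ler_wpM2l //; lra.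
have geo0 : geometric (dist1 (1, 0) s) 2^-1 @ \oo --> 0.
  by apply: cvg_geometric; rewrite ger0_norm; lra.
split; apply: cvg_of_modulus geo0 => n; apply: le_trans (dist n).
  by rewrite lerDl modulus_ge0.
by rewrite lerDr modulus_ge0.
Qed.

Theorem theorem2p3p6 (R : realType) :
  \forall x \near (0 : complexes R),
    [/\ cvgn (series (A_terms x)),
        cvgn (series (C_terms x)),
        C_sum x != 0,
        forall n : nat, (1 <= n)%N -> word_den (word x n) != 0
      & (fun n : nat => cf_value (word x n)) @ \oo --> A_sum x / C_sum x].
Proof.
near=> x.
have x_small : modulus x <= 100^-1.
  suff: `|x| < (100^-1)%:C%C by rewrite modulusE ltcR => /ltW.
  near: x; apply: (@nbhs0_lt (complexes R) (complexes R)); rewrite ltcR; lra.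
have x0 := modulus_ge0 x.
have z_small : modulus (x ^+ 2) <= 32^-1 by rewrite modulusX; nra.
set C := raney_sum (x ^+ 2) 1.
have C2E : raney_sum (x ^+ 2) 2 = C ^+ 2 by rewrite [C ^+ 2]expr2 raney_sumM.
have C3E : raney_sum (x ^+ 2) 3 = C ^+ 3.
  by rewrite [C ^+ 3]exprS -C2E raney_sumM.
have CE : C = 1 + x ^+ 2 * C ^+ 3 by rewrite -C3E; apply: raney_sum1.
have C_cvg : series (C_terms x) @ \oo --> C.
  by rewrite C_termsE; apply: raney_series_cvg.
have A_cvg : series (A_terms x) @ \oo --> x * C ^+ 2.
  have -> : series (A_terms x) = cst x \* series (raney_terms (x ^+ 2) 2).
    apply/funext => n; rewrite /series /= mulr_sumr.
    by apply: eq_bigr => i _; apply: A_termsE.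
  rewrite -C2E; apply: cvgM; first exact: cvg_cst.
  exact: raney_series_cvg.
have C_sumE : C_sum x = C by apply: cvg_lim C_cvg; apply: norm_hausdorff.
have A_sumE : A_sum x = x * C ^+ 2.
  by apply: cvg_lim A_cvg; apply: norm_hausdorff.
have C_neq0 : C != 0.
  apply/eqP => C0; move: CE; rewrite C0 expr0n mulr0 addr0.
  by move=> /esym/eqP; rewrite oner_eq0.
have C_le2 : modulus C <= 2 by apply: modulus_raney_sum1.
have box : in_box (C, x * C ^+ 2).
  split=> //=; rewrite modulusM modulusX.
  have := modulus_ge0 C; nra.
have fixed : square_step x (C, x * C ^+ 2) = (C, x * C ^+ 2).
  rewrite /square_step /=.
  have tE : C ^+ 2 - (x * C ^+ 2) ^+ 2 = C.
    transitivity (C * (C - x ^+ 2 * C ^+ 3)); first by ring.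
    by rewrite {2}CE addrK mulr1.
  rewrite tE; congr pair; first by rewrite [RHS]CE; ring.
  have -> : x * (C * (x * C ^+ 2)) = x ^+ 2 * C ^+ 3 by ring.
  by rewrite -CE; ring.
have [a_cvg c_cvg] := square_column_cvg x_small box fixed.
have den_cvg : (fun n => word_den (word x n.+1)) @ \oo --> C.
  have -> : (fun n => word_den (word x n.+1)) =
    cst 1 \+ (cst x \* ((fun n => (square_column x n).1) \*
                        (fun n => (square_column x n).2))).
    by apply/funext => n; case: (word_num_den x n).
  have -> : C = 1 + x * (C * (x * C ^+ 2)) by rewrite [LHS]CE; ring.
  apply: cvgD; first exact: cvg_cst.
  apply: cvgM; first exact: cvg_cst.
  by apply: cvgM; [exact: a_cvg | exact: c_cvg].
split.
- exact: cvgP A_cvg.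
- exact: cvgP C_cvg.
- by rewrite C_sumE.
- case=> // n _; case: (word_num_den x n) => _ ->.
  have [a2 c1] := square_column_box n x_small.
  apply/eqP => den0.
  have := modulusM_le x_small (modulusM_le a2 c1).
  have -> : x * ((square_column x n).1 * (square_column x n).2) = - 1.
    by apply/eqP; rewrite -addr_eq0 addrC den0.
  rewrite modulusN modulus1; lra.
- rewrite C_sumE A_sumE -cvg_shiftS.
  have -> : [sequence cf_value (word x n.+1)]_n =
      (cst x \* ((fun n => (square_column x n).1) \*
      (fun n => (square_column x n).1))) \*
      (fun n => (word_den (word x n.+1))^-1).
    apply/funext => n; rewrite /cf_value /=.
    by case: (word_num_den x n) => -> _; rewrite expr2.
  apply: cvgM; last exact: (cvgV C_neq0 den_cvg).
  apply: cvgM; first exact: cvg_cst.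
  by rewrite expr2; apply: cvgM; exact: a_cvg.
Unshelve. all: by end_near.
Qed.
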